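(* For every integer $n \geq 0$, \[ \nu_2(P_n(2)) = (n \bmod 2) - \nu_2(n!). \]
   Context: $P_n(x)$ denotes the $n$-th Legendre polynomial, $P_n(x) = \sum_{k=0}^{n} \binom{n}{k}\binom{n+k}{k}\left(\frac{x-1}{2}\right)^k$. For a nonzero rational $r$, $\nu_2(r)$ is its $2$-adic valuation (exponent of $2$ in $r$). *)

(* Defs.v *)
From mathcomp Require Import all_boot all_order all_algebra.

Set Implicit Arguments.
Unset Strict Implicit.
Unset Printing Implicit Defensive.

Import GRing.Theory Num.Theory.
Local Open Scope ring_scope.

Definition legendre (n : nat) : {poly rat} :=
  \sum_(0 <= k < n.+1)
    ('C(n, k) * 'C(n + k, k))%:R *: (2^-1 *: ('X - 1)) ^+ k.

(* Meaningful for r != 0 only: the value at 0 is the junk value 0. *)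
Definition nu2 (r : rat) : int :=
  (logn 2 `|numq r|)%:Z - (logn 2 `|denq r|)%:Z.

(* Main.v *)
Require Import Defs.
From mathcomp Require Import all_boot all_order all_algebra.
From mathcomp Require Import ring zify.

Import GRing.Theory Num.Theory.
Local Open Scope ring_scope.

(** Multiplying Bonnet's recurrence at [x = 2] by [(n+1)!] shows that
    [Q_n = n! P_n(2)] satisfies [Q_(n+2) = 2 (2n+3) Q_(n+1) - (n+1)^2 Q_n] with
    [Q_0 = 1] and [Q_1 = 2].  Hence every [Q_n] is an integer, odd for even [n]
    and congruent to 2 modulo 4 for odd [n]. *)

Definition legendre_coef (n k : nat) : rat := ('C(n, k) * 'C(n + k, k))%:R.

(** Truncated subtraction differs from subtraction in [rat] only when [n < k]; where this is used,
    [m] then contains a vanishing binomial. *)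
Lemma natr_subM (n k m : nat) :
  (k <= n)%N || (m == 0%N) -> (n - k)%N%:R * m%:R = (n%:R - k%:R) * m%:R :> rat.
Proof. by case/orP => [le_kn|/eqP->]; [rewrite natrB | rewrite mulr0n !mulr0]. Qed.

Lemma legendre_coefSn (n k : nat) :
  (n.+1%:R - k%:R) * legendre_coef n.+1 k =
  (n.+1 + k)%:R * legendre_coef n k.
Proof.
rewrite -natr_subM -?natrM; last first.
  by case: leqP => //= ltnk; rewrite bin_small.
(* The extra factor [n.+1] lets the absorption identities [e1] and [e2] apply to one binomial
   each. *)
congr _%:R; apply/eqP; rewrite -(eqn_pmul2l (ltn0Sn n)); apply/eqP.
have e1 : ((n.+1 - k) * 'C(n.+1, k) = n.+1 * 'C(n, k))%N.
  by rewrite -mul_bin_down.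
have e2 : (n.+1 * 'C(n.+1 + k, k) = (n.+1 + k) * 'C(n + k, k))%N.
  by rewrite mul_bin_down addnK.
transitivity (((n.+1 - k) * 'C(n.+1, k)) * (n.+1 * 'C(n.+1 + k, k)))%N; first by ring.
by rewrite e1 e2; ring.
Qed.

Lemma legendre_coefnS (n k : nat) :
  k.+1%:R ^+ 2 * legendre_coef n k.+1 =
  (n + k).+1%:R * (n%:R - k%:R) * legendre_coef n k.
Proof.
rewrite -mulrA -natr_subM -?natrM -?natrX -?natrM; last first.
  by case: leqP => //= ltnk; rewrite bin_small.
congr _%:R.
have e1 : (k.+1 * 'C(n, k.+1) = (n - k) * 'C(n, k))%N by rewrite mul_bin_left.
have e2 : (k.+1 * 'C(n + k.+1, k.+1) = (n + k).+1 * 'C(n + k, k))%N.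
  by rewrite addnS mul_bin_diag.
transitivity ((k.+1 * 'C(n, k.+1)) * (k.+1 * 'C(n + k.+1, k.+1)))%N; first by ring.
by rewrite e1 e2; ring.
Qed.

Lemma legendre_coef0 (n : nat) : legendre_coef n 0 = 1.
Proof. by rewrite /legendre_coef !bin0. Qed.

Lemma legendre_coef_gt (n k : nat) : (n < k)%N -> legendre_coef n k = 0.
Proof. by move=> ltnk; rewrite /legendre_coef bin_small. Qed.

(** Bonnet's recurrence read off at [y ^+ k.+1], where x = 1 + 2y. After multiplication by (k+1)^2,
    every term is a multiple of [legendre_coef n.+1 k]. *)
Lemma legendre_coef_rec (n k : nat) :
  n.+2%:R * legendre_coef n.+2 k.+1 =
  (n.*2 + 3)%:R * (legendre_coef n.+1 k.+1 + 2 * legendre_coef n.+1 k)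
  - n.+1%:R * legendre_coef n k.+1.
Proof.
have nzk : k.+1%:R ^+ 2 != 0 :> rat by rewrite expf_neq0 // pnatr_eq0.
have H2 : k.+1%:R ^+ 2 * legendre_coef n.+2 k.+1 =
    (n + k + 3)%:R * (n + k + 2)%:R * legendre_coef n.+1 k.
  rewrite legendre_coefnS -mulrA legendre_coefSn; ring.
have H0 : k.+1%:R ^+ 2 * legendre_coef n k.+1 =
    (n%:R - k%:R) * (n.+1%:R - k%:R) * legendre_coef n.+1 k.
  rewrite legendre_coefnS -[RHS]mulrA legendre_coefSn; ring.
apply: (mulfI nzk).
rewrite mulrCA H2 mulrBr [X in _ - X]mulrCA H0.
rewrite [X in _ = X - _]mulrCA mulrDr legendre_coefnS -muln2; ring.
Qed.

(** Terms beyond [n] vanish, so the free bound [N] lets polynomials of different degrees be summed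
    over one range. *)
Lemma horner_legendre (n N : nat) (x : rat) : (n < N)%N ->
  (legendre n).[x] = \sum_(0 <= k < N) legendre_coef n k * ((x - 1) / 2) ^+ k.
Proof.
move=> ltnN; rewrite /legendre horner_sum (big_cat_nat _ ltnN) //=.
rewrite [X in _ = _ + X]big_nat_cond [X in _ = _ + X]big1 ?addr0; last first.
  by move=> k /andP[/andP[ltnk _] _]; rewrite legendre_coef_gt ?mul0r.
apply: eq_bigr => k _.
by rewrite !hornerE [2^-1 * _]mulrC.
Qed.

Lemma legendre_rec (n : nat) (x : rat) :
  n.+2%:R * (legendre n.+2).[x] =
  (n.*2 + 3)%:R * x * (legendre n.+1).[x] - n.+1%:R * (legendre n).[x].
Proof.
set y := (x - 1) / 2; have -> : x = 1 + 2 * y by rewrite /y; field.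
have y_eq : (1 + 2 * y - 1) / 2 = y by field.
rewrite (@horner_legendre _ _ _ (ltnSn n.+2)).
rewrite (@horner_legendre _ _ _ (leqW (leqW (ltnSn n)))).
(* Two expansions of the same value: [e3] for its plain occurrence, and the shorter [e2] for the one
   multiplied by [y], whose exponents shift by one. *)
have e3 := @horner_legendre _ _ (1 + 2 * y) (leqW (ltnSn n.+1)).
have e2 := @horner_legendre _ _ (1 + 2 * y) (ltnSn n.+1).
set L := (legendre n.+1).[_] in e2 e3 *.
have -> : (n.*2 + 3)%:R * (1 + 2 * y) * L = (n.*2 + 3)%:R * (L + 2 * y * L).
  by ring.
rewrite {1}e3 e2 !y_eq.
rewrite !(big_nat_recl n.+2) ?leq0n // !legendre_coef0 !expr0.
pose F k := legendre_coef n.+1 k * y ^+ k.+1.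
have -> : 2 * y * (\sum_(0 <= k < n.+2) legendre_coef n.+1 k * y ^+ k) =
    2 * \sum_(0 <= k < n.+2) F k.
  by rewrite -mulrA !big_distrr; apply: eq_bigr => k _; rewrite /F exprS /=; ring.
(* The constant terms agree because n + 2 = (2n + 3) - (n + 1). *)
transitivity (n.+2%:R + \sum_(0 <= k < n.+2)
  n.+2%:R * legendre_coef n.+2 k.+1 * y ^+ k.+1).
  by rewrite mulrDr !mulr1 big_distrr; congr (_ + _); apply: eq_bigr => k _ /=; ring.
transitivity (n.+2%:R + ((n.*2 + 3)%:R *
   (\sum_(0 <= k < n.+2) legendre_coef n.+1 k.+1 * y ^+ k.+1 +
    2 * \sum_(0 <= k < n.+2) F k) -
   n.+1%:R * \sum_(0 <= k < n.+2) legendre_coef n k.+1 * y ^+ k.+1)).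
  congr (_ + _); rewrite !big_distrr -big_split /= !big_distrr -sumrB /=.
  by apply: eq_bigr => k _; rewrite legendre_coef_rec /F; ring.
rewrite -muln2; ring.
Qed.

(** The fraction need not be reduced: cross-multiplying with [numq] and [denq] and taking [logn 2]
    gives the same difference. *)
Lemma nu2_divz (a b : int) : a != 0 -> b != 0 ->
  nu2 (a%:~R / b%:~R) = (logn 2 `|a|)%:Z - (logn 2 `|b|)%:Z.
Proof.
move=> a0 b0; set r := _ / _.
have b0r : b%:~R != 0 :> rat by rewrite intr_eq0.
have r0 : r != 0 by rewrite mulf_neq0 ?invr_eq0 ?intr_eq0.
have /intr_inj/(congr1 absz) : (numq r * b)%:~R = (a * denq r)%:~R :> rat.
  by rewrite !intrM numqE mulrAC divfK.
rewrite !abszM => /(congr1 (logn 2)).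
rewrite !lognM ?absz_gt0 ?numq_eq0 ?denq_eq0 //.
rewrite /nu2; lia.
Qed.

Definition fact_legendre2 (n : nat) : rat := n`!%:R * (legendre n).[2].

Lemma fact_legendre2_rec (n : nat) :
  fact_legendre2 n.+2 =
  2 * (n.*2 + 3)%:R * fact_legendre2 n.+1 - n.+1%:R ^+ 2 * fact_legendre2 n.
Proof.
rewrite /fact_legendre2 factS natrM -mulrA mulrCA legendre_rec factS natrM; ring.
Qed.

(** The recurrence has order two, so the induction carries a consecutive pair. Coefficients (2m+1)^2
    and (2m+2)^2 alternate between odd and divisible by 4. *)
Lemma fact_legendre2_parity (m : nat) : exists a b : int,
  fact_legendre2 m.*2 = (2 * a + 1)%:~R /\
  fact_legendre2 m.*2.+1 = (2 * (2 * b + 1))%:~R.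
Proof.
elim: m => [|m [a [b [ha hb]]]].
  exists 0, 0; split; rewrite /fact_legendre2 (@horner_legendre _ 2) //;
  by rewrite unlock.
pose M := m%:Z.
(* Obtained by solving the recurrence for [a']; the tail is -((2M+1)^2 + 1)/2. The next witness
   comes from the recurrence one index later. *)
pose a' := 2 * (4 * M + 3) * (2 * b + 1) - (2 * M + 1) ^+ 2 * a - 2 * M ^+ 2 - 2 * M - 1.
have ha' : fact_legendre2 m.+1.*2 = (2 * a' + 1)%:~R.
  rewrite doubleS fact_legendre2_rec ha hb /a' /M -!muln2; ring.
exists a', ((4 * M + 5) * a' + (2 * M + 2) - 2 * (M + 1) ^+ 2 * (2 * b + 1)).
split => //.
rewrite doubleS fact_legendre2_rec -doubleS ha' hb /M -!muln2; ring.
Qed.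

Lemma fact_legendre2_eq (n : nat) : exists2 q : int,
  odd `|q| & fact_legendre2 n = ((2 ^ (n %% 2))%N%:Z * q)%:~R.
Proof.
have [a [b [ha hb]]] := fact_legendre2_parity n./2.
rewrite modn2; have := odd_double_half n; case: (odd n) => /= <-.
  by exists (2 * b + 1); [lia | rewrite add1n hb].
by exists (2 * a + 1); [lia | rewrite add0n ha expn0 mul1r].
Qed.

Theorem theorem5 (n : nat) :
  (legendre n).[2] != 0 /\
  nu2 (legendre n).[2] = (n %% 2)%N%:Z - nu2 (n`!)%:R.
Proof.
have [q q_odd hq] := fact_legendre2_eq n.
have q0 : q != 0 by apply: contraTneq q_odd => ->.
have f0 : (n`!)%:Z != 0 by rewrite eqz_nat -lt0n fact_gt0.
have p0 : (2 ^ (n %% 2))%N%:Z * q != 0.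
  by rewrite mulf_neq0 // eqz_nat expn_eq0.
have -> : (legendre n).[2] = ((2 ^ (n %% 2))%N%:Z * q)%:~R / (n`!)%:Z%:~R.
  by rewrite -hq mulrAC mulfV ?mul1r // pnatr_eq0 -lt0n fact_gt0.
split; first by rewrite mulf_neq0 ?invr_eq0 ?intr_eq0.
(* With denominator 1, [nu2_divz] evaluates both sides. *)
have -> : n`!%:R = (n`!)%:Z%:~R / 1%:~R :> rat by rewrite divr1.
rewrite !nu2_divz // abszM !absz_nat lognM ?expn_gt0 ?absz_gt0 //.
have q2 : logn 2 `|q| = 0%N by apply/eqP; rewrite logn_coprime // coprime2n.
by rewrite lognX q2 logn1 muln1 addn0 subr0.
Qed.
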